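(* Let $(E,\|\cdot\|)$ be a normed linear space over $\mathbb{K}$ ($\mathbb{K}=\mathbb{R}$ or $\mathbb{C}$), let $n\ge2$ and let $\mathbf{x}=(x_1,\dots,x_n)\in E^n$. Then for all real $q,r\ge1$ each of the following three inequalities holds: $$\|\mathbf{x}\|_{h,n,q+r}^{q+r}\le\frac1n\|\mathbf{x}\|_{h,n,q}^{q}\|\mathbf{x}\|_{h,n,r}^{r}+\frac1{12}qr(n^2-1)n\,\|\mathbf{x}\|_{n,\infty}^{q+r-2}\|\Delta\mathbf{x}\|_{n-1,\infty}^2;$$ $$\|\mathbf{x}\|_{h,n,q+r}^{q+r}\le\frac1n\|\mathbf{x}\|_{h,n,q}^{q}\|\mathbf{x}\|_{h,n,r}^{r}+\frac16(n^2-1)qr\,\|\mathbf{x}\|_{n,\infty}^{q+r-2}\|\Delta\mathbf{x}\|_{h,n-1,\alpha}\|\Delta\mathbf{x}\|_{h,n-1,\beta}$$ for all $\alpha,\beta>1$ with $\frac1\alpha+\frac1\beta=1$; and $$\|\mathbf{x}\|_{h,n,q+r}^{q+r}\le\frac1n\|\mathbf{x}\|_{h,n,q}^{q}\|\mathbf{x}\|_{h,n,r}^{r}+\frac12(n-1)qr\,\|\mathbf{x}\|_{n,\infty}^{q+r-2}\|\Delta\mathbf{x}\|_{h,n-1,1}^2.$$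
   Context: For $\mathbf{x}=(x_1,\dots,x_n)\in E^n$ with $n\ge2$, $\Delta\mathbf{x}:=(\Delta x_1,\dots,\Delta x_{n-1})\in E^{n-1}$ with $\Delta x_k:=x_{k+1}-x_k$. For $m\ge1$ and $\mathbf{y}=(y_1,\dots,y_m)\in E^m$, $\|\mathbf{y}\|_{m,\infty}:=\max_{j}\|y_j\|$. For $p\in[1,\infty]$ let $\mathbb{B}_{m,p}=\{\lambda=(\lambda_1,\dots,\lambda_m)\in\mathbb{K}^m : \|\lambda\|_{m,p}\le 1\}$, where $\|\lambda\|_{m,p}=(\sum_{k=1}^m|\lambda_k|^p)^{1/p}$ for $p<\infty$ and $\|\lambda\|_{m,\infty}=\max_k|\lambda_k|$. For real $s\ge1$, the hypo-$s$-norm on $E^m$ is $$\|\mathbf{y}\|_{h,m,s}:=\sup_{\lambda\in\mathbb{B}_{m,p}}\left\|\sum_{j=1}^m\lambda_jy_j\right\|,$$ where $p$ is the conjugate exponent of $s$ ($\frac1p+\frac1s=1$ if $s>1$; $p=\infty$ if $s=1$). Convention: $0^0=1$. *)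

(* Defs.v *)
From HB Require Import structures.
From mathcomp Require Import all_boot all_order all_algebra.
From mathcomp Require Import complex.
From mathcomp Require Import all_classical all_reals all_analysis.
Set Implicit Arguments.
Unset Strict Implicit.
Unset Printing Implicit Defensive.
Import Order.TTheory GRing.Theory Num.Theory numFieldNormedType.Exports.
Local Open Scope classical_set_scope.
Local Open Scope ring_scope.

Inductive scalar_kind := RealScalars | ComplexScalars.

Definition scalars (R : realType) (k : scalar_kind) : numFieldType :=
  match k with
  | RealScalars => R
  | ComplexScalars => complex R
  end.

Definition to_real (R : realType) (k : scalar_kind) : scalars R k -> R :=
  match k return scalars R k -> R with
  | RealScalars => fun z => z
  | ComplexScalars => fun z => complex.Re z
  end.

Section norms.
Variables (R : realType) (k : scalar_kind).
Local Notation K := (scalars R k).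

(* The library norm takes values in the field of scalars; its values are
   nonnegative real elements, so that to_real loses nothing. This gives both
   the norm of a normed space over K and the modulus of a scalar. *)
Definition rnorm (V : normedZmodType K) (v : V) : R := to_real `|v|.

(* With m > 0 this is the maximum: the initial value 0 is irrelevant, the
   norms being nonnegative. *)
Definition max_norm (V : normedZmodType K) (m : nat) (y : 'I_m -> V) : R :=
  \big[Num.max/0]_(j < m) rnorm (y j).

(* Only used for p in [1, +oo]; the value at -oo is junk. *)
Definition lp_norm (m : nat) (p : \bar R) (l : 'I_m -> K) : R :=
  match p with
  | p%:E => (\sum_(j < m) rnorm (l j) `^ p) `^ p^-1
  | _ => max_norm l
  end.

(* The set below is nonempty and, for 1 <= s, bounded, so that the real sup is
   the actual supremum. *)
Definition hypo_norm (E : normedModType K) (m : nat) (s : R)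
    (y : 'I_m -> E) : R :=
  sup [set rnorm (\sum_(j < m) l j *: y j) | l in
        [set l : 'I_m -> K | lp_norm (hoelder_conjugate s%:E) l <= 1]].

End norms.

Lemma diff_ord_proof (n : nat) (j : 'I_n.-1) : (j.+1 < n)%N.
Proof. by case: n j => [|n] [j]. Qed.

(* j-th entry x_{j+1} - x_j, with indices starting at 0. *)
Definition fwd_diff (V : zmodType) (n : nat) (x : 'I_n -> V) : 'I_n.-1 -> V :=
  fun j => x (Ordinal (diff_ord_proof j)) -
           x (Ordinal (ltnW (diff_ord_proof j))).

(* Main.v *)
(** By Hahn-Banach and Hoelder, the s-th power of the hypo-s-norm is the supremum
    of [\sum_j |f (x_j)|^s] over the functionals [f] of norm at most one. It is
    thus enough to bound [\sum_j t_j^(q+r)] for each sequence [t_j = |f (x_j)|].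
    By Chebyshev's identity, [n \sum a_j b_j - \sum a_j \sum b_j] is the sum of
    [(a_j - a_i) (b_j - b_i)] over the pairs [i < j]; with [a = t^q], [b = t^r]
    and [|u^q - v^q| <= q M^(q-1) |u - v|] the defect is at most
    [q r M^(q+r-2)] times the sum of [(t_j - t_i)^2]. Finally [|t_j - t_i|] is at
    most the sum of the [|f (Delta x_l)|] for [i <= l < j], whose square is
    estimated by the maximum, by Cauchy-Schwarz and Hoelder, or by the square of
    the full sum. *)
Require Import Defs.
From HB Require Import structures.
From mathcomp Require Import all_boot all_order all_algebra.
From mathcomp Require Import complex ring lra.
From mathcomp Require Import all_classical all_reals all_analysis.
Import Order.TTheory GRing.Theory Num.Theory numFieldNormedType.Exports.
Set Implicit Arguments.
Unset Strict Implicit.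
Unset Printing Implicit Defensive.
Local Open Scope classical_set_scope.
Local Open Scope ring_scope.

(** * Real and complex scalars *)

(** Embedding of the reals into the scalars. With it, real multiples can be taken in a module over
    [K] without giving the module a second structure. *)
Definition of_real (R : realType) (k : scalar_kind) : R -> scalars R k :=
  match k return R -> scalars R k with
  | RealScalars => fun a => a
  | ComplexScalars => fun a => (a%:C)%C
  end.

Section ScalarField.
Variables (R : realType) (k : scalar_kind).
Local Notation K := (scalars R k).
Local Notation of_real := (@of_real R k).
Local Notation to_real := (@to_real R k).

Lemma of_real_is_zmod_morphism : zmod_morphism of_real.
Proof. by rewrite /of_real; case: k => // a b /=; rewrite rmorphB. Qed.

Lemma of_real_is_monoid_morphism : monoid_morphism of_real.
Proof. by rewrite /of_real; case: k => //; split=> // a b; rewrite rmorphM. Qed.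

HB.instance Definition _ :=
  GRing.isZmodMorphism.Build R K of_real of_real_is_zmod_morphism.
HB.instance Definition _ :=
  GRing.isMonoidMorphism.Build R K of_real of_real_is_monoid_morphism.

Lemma to_real_is_zmod_morphism : zmod_morphism to_real.
Proof. by rewrite /to_real; case: k => // -[a b] [c d]. Qed.

HB.instance Definition _ :=
  GRing.isZmodMorphism.Build K R to_real to_real_is_zmod_morphism.

Lemma to_realB z w : to_real (z - w) = to_real z - to_real w.
Proof. exact: raddfB. Qed.

Lemma to_realZ a z : to_real (of_real a * z) = a * to_real z.
Proof.
move: z; rewrite /to_real /of_real; case: k => // -[b c] /=.
by rewrite mul0r subr0.
Qed.

Lemma of_realK : cancel of_real to_real.
Proof.
move=> a; rewrite -[of_real a]mulr1 to_realZ /to_real.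
by case: k; rewrite /= mulr1.
Qed.

Lemma to_real_le z w : z <= w -> to_real z <= to_real w.
Proof.
by move: z w; rewrite /to_real; case: k => // z w; rewrite lecE => /andP[].
Qed.

Lemma to_realK z : 0 <= z -> of_real (to_real z) = z.
Proof.
by move: z; rewrite /to_real /of_real; case: k => // z /ger0_real /RRe_real.
Qed.

Lemma norm_of_real a : `|of_real a| = of_real `|a|.
Proof.
rewrite /of_real; case: k => //=.
by rewrite normc_def /= expr0n addr0 sqrtr_sqr.
Qed.

Lemma to_real_le_norm z : to_real z <= to_real `|z|.
Proof.
move: z; rewrite /to_real; case: k => [z|z]; first exact: ler_norm.
have := normc_ge_Re z; rewrite lecE => /andP[_ /=].
by apply: le_trans; rewrite ler_norm.
Qed.

End ScalarField.

Section NormedModule.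
Variables (R : realType) (k : scalar_kind).
Local Notation K := (scalars R k).

Section normed_zmod.
Variable V : normedZmodType K.

Lemma rnormE (v : V) : `|v| = of_real k (rnorm v).
Proof. by rewrite /rnorm to_realK. Qed.

Lemma rnorm_ge0 (v : V) : 0 <= rnorm v.
Proof. by rewrite -[0](@raddf0 K R (@to_real R k)); exact: to_real_le. Qed.

Lemma rnorm0 : rnorm (0 : V) = 0.
Proof. by rewrite /rnorm normr0 raddf0. Qed.

Lemma ler_rnormD (u v : V) : rnorm (u + v) <= rnorm u + rnorm v.
Proof. rewrite /rnorm -raddfD; apply: to_real_le; exact: ler_normD. Qed.

Lemma rnormN (v : V) : rnorm (- v) = rnorm v.
Proof. by rewrite /rnorm normrN. Qed.

Lemma ler_rnorm_sum I (s : seq I) (P : pred I) (F : I -> V) :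
  rnorm (\sum_(i <- s | P i) F i) <= \sum_(i <- s | P i) rnorm (F i).
Proof. rewrite /rnorm -raddf_sum; apply: to_real_le; exact: ler_norm_sum. Qed.

Lemma ler_dist_rnorm (u v : V) : `|rnorm u - rnorm v| <= rnorm (u - v).
Proof.
rewrite ler_norml; apply/andP; split.
  have := ler_rnormD (v - u) u.
  by rewrite subrK -[v - u]opprB rnormN; lra.
by have := ler_rnormD (u - v) v; rewrite subrK; lra.
Qed.

Lemma rnorm_le_max m (y : 'I_m -> V) j : rnorm (y j) <= max_norm y.
Proof. exact: le_bigmax. Qed.

End normed_zmod.

Lemma rnormM (z w : K) : rnorm (z * w) = rnorm z * rnorm w.
Proof. by rewrite {1}/rnorm normrM [`|z|]rnormE to_realZ. Qed.

Lemma rnorm_of_real (a : R) : rnorm (of_real k a) = `|a|.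
Proof. by rewrite /rnorm norm_of_real of_realK. Qed.

Lemma rnorm_phase (z : K) : z != 0 -> rnorm (`|z| / z) = 1.
Proof.
move=> z0; rewrite /rnorm normrM normfV normr_id divff ?normr_eq0 //.
by rewrite -(rmorph1 (of_real k)) of_realK.
Qed.

Lemma rnormZ (E : normedModType K) (z : K) (v : E) :
  rnorm (z *: v) = rnorm z * rnorm v.
Proof. by rewrite {1}/rnorm normrZ [`|z|]rnormE to_realZ. Qed.

End NormedModule.

(** * The Hahn-Banach theorem *)

Section HahnBanach.
Variables (R : realType) (k : scalar_kind) (E : lmodType (scalars R k)).
Implicit Types (p g : E -> R) (u v x : E).
Local Notation "a *:: v" := (of_real k a *: v) (at level 40).

(** Only real multiples occur, although [E] is a module over [K]: the Hahn-Banach argument is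
    carried out over the reals for both kinds of scalars. *)
Definition sublinear p :=
  (forall u v, p (u + v) <= p u + p v) /\
  (forall a v, 0 <= a -> p (a *:: v) = a * p v).

Lemma sublinear0 p : sublinear p -> p 0 = 0.
Proof. by case=> _ pZ; rewrite -(scale0r 0) -(rmorph0 (of_real k)) pZ ?mul0r. Qed.

Lemma sublinearN_ge p v : sublinear p -> - p (- v) <= p v.
Proof.
move=> ps; have [pD _] := ps.
by have := pD v (- v); rewrite subrr sublinear0 //; lra.
Qed.

(** Shared by [linearize_at], where the family is indexed by the shift, and by the infimum of a
    chain in the Zorn argument. The family is not assumed sublinear: a third index only has to do as
    well as the two given ones. *)
Lemma sublinear_inf (I : Type) (S : set I) (F : I -> E -> R) :
  S !=set0 -> (forall v, has_lbound [set F i v | i in S]) ->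
  (forall i, S i -> F i 0 = 0) ->
  (forall i j u v, S i -> S j ->
     exists2 l, S l & F l (u + v) <= F i u + F j v) ->
  (forall a i v, 0 < a -> S i -> exists2 l, S l & F l (a *:: v) <= a * F i v) ->
  sublinear (fun v => inf [set F i v | i in S]).
Proof.
move=> S0 Flb F0 FD FZ; set P := (X in sublinear X).
have PF v i : S i -> P v <= F i v by move=> Si; apply: ge_inf => //; exists i.
have Pge v c : (forall i, S i -> c <= F i v) -> c <= P v.
  move=> cF; apply: lb_le_inf => [|_ [i Si <-]]; last exact: cF.
  by case: S0 => i Si; exists (F i v), i.
have PZ a v : 0 < a -> P (a *:: v) <= a * P v.
  move=> a0; rewrite -ler_pdivrMl //; apply: (Pge) => i Si.
  have [l Sl Fl] := FZ a i v a0 Si.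
  by rewrite ler_pdivrMl //; apply: le_trans Fl; exact: PF.
split=> [u v|a v].
  rewrite -lerBlDr; apply: (Pge) => i Si; rewrite lerBlDr -lerBlDl.
  apply: (Pge) => j Sj; rewrite lerBlDl.
  by have [l Sl] := FD i j u v Si Sj; apply: le_trans; exact: PF.
(* For [a > 0] the missing inequality is [PZ] for [a^-1] at the vector [a *:: v]. *)
rewrite le_eqVlt => /predU1P[<-|a0]; last first.
  apply/eqP; rewrite eq_le PZ //= -ler_pdivlMl //.
  have := PZ a^-1 (a *:: v).
  by rewrite invr_gt0 scalerA -rmorphM mulVf ?gt_eqF // rmorph1 scale1r; apply.
rewrite mul0r rmorph0 scale0r; apply/eqP; rewrite eq_le; apply/andP; split.
  by case: S0 => i Si; rewrite -(F0 i Si); exact: PF.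
by apply: (Pge) => i /F0 ->.
Qed.

(* The largest sublinear functional below [p] that is at most [- p x] at [- x]:
   it is linear along the line of [x]. *)
Definition linearize_at p x v :=
  inf [set p (v + t *:: x) - t * p x | t in [set t | 0 <= t]].

(** By subadditivity, t p(x) = p(tx) is at most p(v + tx) + p(-v), whence the lower bound -
    p(-v). *)
Lemma linearize_at_lbound p x v : sublinear p ->
  has_lbound [set p (v + t *:: x) - t * p x | t in [set t | 0 <= t]].
Proof.
move=> ps; have [pD pZ] := ps.
exists (- p (- v)) => _ [t /= t0 <-]; rewrite lerBrDl lerBlDr -pZ //.
by apply: le_trans (pD _ _); rewrite addrAC subrr add0r.
Qed.

Lemma linearize_at_le p x v t : sublinear p -> 0 <= t ->
  linearize_at p x v <= p (v + t *:: x) - t * p x.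
Proof.
by move=> ps t0; apply: ge_inf; [exact: linearize_at_lbound|exists t].
Qed.

Lemma sublinear_linearize_at p x : sublinear p -> sublinear (linearize_at p x).
Proof.
move=> ps; have [pD pZ] := ps; apply: sublinear_inf => /=.
- by exists 0 => /=.
- by move=> v; exact: linearize_at_lbound.
- by move=> t t0; rewrite add0r pZ // subrr.
- move=> s t u v s0 t0; exists (s + t); first exact: addr_ge0.
  have -> : u + v + (s + t) *:: x = (u + s *:: x) + (v + t *:: x).
    by rewrite rmorphD scalerDl addrACA.
  by have := pD (u + s *:: x) (v + t *:: x); lra.
- move=> a t v a0 t0; exists (a * t); first by rewrite mulr_ge0 // ltW.
  by rewrite rmorphM -scalerA -scalerDr pZ ?(ltW a0) // mulrBr mulrA.
Qed.

Lemma linearize_at_le_self p x v : sublinear p -> linearize_at p x v <= p v.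
Proof.
move=> ps; apply: le_trans (linearize_at_le x v ps (lexx 0)) _.
by rewrite rmorph0 scale0r addr0 mul0r subr0.
Qed.

Lemma linearize_atN p x : sublinear p -> linearize_at p x (- x) <= - p x.
Proof.
move=> ps; apply: le_trans (linearize_at_le x (- x) ps ler01) _.
by rewrite rmorph1 scale1r addNr sublinear0 // mul1r sub0r.
Qed.

Definition real_linear g :=
  (forall u v, g (u + v) = g u + g v) /\ (forall a v, g (a *:: v) = a * g v).

(** Subadditivity at [- u] and [- v] becomes superadditivity after a change of sign; oddness
    likewise extends homogeneity to negative factors. *)
Lemma odd_sublinear_linear g : sublinear g -> (forall v, g (- v) <= - g v) ->
  real_linear g.
Proof.
move=> gs gN; have [gD gZ] := gs.
have gN' v : g (- v) = - g v.
  apply/eqP; rewrite eq_le gN /= lerNl -{2}[v]opprK.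
  by have := sublinearN_ge (- v) gs; rewrite opprK; lra.
split=> [u v|a v].
  apply/eqP; rewrite eq_le gD /=.
  by have := gD (- u) (- v); rewrite -opprD !gN'; lra.
have [a0|a0] := leP 0 a; first exact: gZ.
rewrite -[a *:: v]opprK -scaleNr -rmorphN gN' gZ ?oppr_ge0 ?ltW //.
by rewrite mulNr opprK.
Qed.

(** Zorn's lemma for the reversed pointwise order. The pointwise infimum of a nonempty chain is
    finite because each member is at least - p(-v) at [v]. *)
Lemma minimal_sublinear p : sublinear p ->
  exists g, [/\ sublinear g, forall v, g v <= p v &
    forall h, sublinear h -> (forall v, h v <= g v) -> h = g].
Proof.
move=> ps; pose T := {g | sublinear g /\ forall v, g v <= p v}.
pose below (g h : T) := `[< forall v, sval h v <= sval g v >].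
have [|||A Atot|[g [gs gp]] gmin] := @Zorn T below.
- by move=> g; apply/asboolP.
- move=> h g l /asboolP gh /asboolP lg; apply/asboolP => v.
  exact: le_trans (lg v) (gh v).
- move=> [g gP] [h hP] /asboolP /= hg /asboolP /= gh.
  by apply: eq_exist; apply: funext => v; apply/eqP; rewrite eq_le hg gh.
(* The empty chain has no useful infimum; [p] itself bounds it. *)
- have [->|/set0P A0] := eqVneq A set0.
    have pP : sublinear p /\ forall v, p v <= p v by [].
    by exists (exist _ p pP).
  have Alb v : has_lbound [set sval g v | g in A].
    exists (- p (- v)) => _ [[g [gs gp]] _ /= <-].
    by apply: le_trans (sublinearN_ge v gs); rewrite lerN2.
  pose P v := inf [set sval g v | g in A].
  have PA v (g : T) : A g -> P v <= sval g v.
    by move=> Ag; apply: ge_inf => //; exists g.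
  have Ps : sublinear P.
    apply: sublinear_inf => //.
    + by move=> [g [gs gp]] _; exact: sublinear0.
    (* In a chain, the smaller of [g] and [h] serves as the third index. *)
    + move=> g h u v Ag Ah; have [/asboolP hg|/asboolP gh] := Atot g h Ag Ah.
        exists h => //; have [[hD _] _] := svalP h.
        by apply: le_trans (hD u v) _; rewrite lerD2r.
      exists g => //; have [[gD _] _] := svalP g.
      by apply: le_trans (gD u v) _; rewrite lerD2l.
    + move=> a g v a0 Ag; exists g => //; have [[_ ->]] := svalP g => //.
      exact: ltW.
  have Pp v : P v <= p v.
    have [g Ag] := A0; apply: le_trans (PA v g Ag) _.
    by have [_] := svalP g; apply.
  have PP : sublinear P /\ forall v, P v <= p v by [].
  by exists (exist _ P PP) => g Ag; apply/asboolP => v; exact: PA.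
exists g; split => // h hs hg.
have hP : sublinear h /\ forall v, h v <= p v.
  by split=> // v; exact: le_trans (hg v) (gp v).
have /gmin/(congr1 sval) // : below (exist _ g (conj gs gp)) (exist _ h hP).
exact/asboolP.
Qed.

(** No extension from a subspace is made: a minimal sublinear functional below [linearize_at p u] is
    already linear, and its value at [- u] forces equality at [u]. *)
Theorem hahn_banach p u : sublinear p ->
  exists g, [/\ real_linear g, forall v, g v <= p v & g u = p u].
Proof.
move=> ps; have ls := sublinear_linearize_at u ps.
have [g [gs gp gmin]] := minimal_sublinear ls.
have gl : real_linear g.
  apply: odd_sublinear_linear => // v.
  (* By minimality, linearizing [g] at [v] gives back [g], so [g] inherits the bound of
     [linearize_atN]. *)
  rewrite -{1}(gmin _ (sublinear_linearize_at v gs)).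
    exact: linearize_atN.
  by move=> w; exact: linearize_at_le_self.
have gp' v : g v <= p v.
  exact: le_trans (gp v) (linearize_at_le_self u v ps).
exists g; split => //; apply/eqP; rewrite eq_le gp' /=.
have := le_trans (gp (- u)) (linearize_atN u ps).
have [gD _] := gl; have := gD u (- u); rewrite subrr (sublinear0 gs); lra.
Qed.

End HahnBanach.

(** * Norming functionals over the scalars *)

Lemma rnorm_sublinear (R : realType) (k : scalar_kind)
  (E : normedModType (scalars R k)) : sublinear (fun v : E => rnorm v).
Proof.
by split=> [u v|a v a0]; rewrite ?ler_rnormD // rnormZ rnorm_of_real ger0_norm.
Qed.

(** All that the complexification below uses about the imaginary unit, so that the representation by
    pairs stays hidden. *)
Lemma complex_scalarsP (R : realType) : exists I : scalars R ComplexScalars,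
  [/\ I * I = -1, forall a, to_real (I * of_real _ a) = 0 &
      forall z, exists a b, z = of_real _ a + I * of_real _ b].
Proof.
exists ('i%C : complex R); split=> [|a|z].
- by rewrite -expr2 sqr_i.
- by rewrite /to_real /= mul0r mulr0 subrr.
- by exists (complex.Re z), (complex.Im z); exact: complexE.
Qed.

Lemma real_linear_scalar (R : realType) (k : scalar_kind)
    (E : lmodType (scalars R k)) (g : E -> R) :
  real_linear g -> exists f : {scalar E}, forall v, to_real (f v) = g v.
Proof.
case: k E g => E g [gD gZ].
  have gs : scalar (g : E -> scalars R RealScalars).
    by move=> a v w; rewrite gD gZ.
  pose gL := GRing.isLinear.Build _ _ _ _ (g : E -> scalars R RealScalars) gs.
  by exists (HB.pack (g : E -> scalars R RealScalars) gL : {scalar E}).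
have [I [II reI zI]] := complex_scalarsP R.
(* The classical complexification g(v) - i g(iv): its real part is [g], and it commutes with
   multiplication by i. *)
pose f v := of_real ComplexScalars (g v) - I * of_real _ (g (I *: v)).
have fD v w : f (v + w) = f v + f w.
  by rewrite /f scalerDr !gD !rmorphD mulrDr opprD addrACA.
have fZ a v : f (of_real _ a *: v) = of_real _ a * f v.
  rewrite /f scalerA (mulrC I (of_real _ a)) -scalerA !gZ !rmorphM.
  by rewrite mulrBr [in RHS]mulrCA.
have gN v : g (- v) = - g v.
  by rewrite -scaleN1r -(rmorph1 (of_real _)) -rmorphN gZ mulN1r.
have fI v : f (I *: v) = I * f v.
  rewrite /f scalerA II scaleN1r gN rmorphN mulrN mulrBr mulrA II.
  by rewrite mulN1r !opprK addrC.
have fs : scalar f.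
  move=> z v w; have [a [b ->]] := zI z.
  by rewrite fD scalerDl fD -scalerA fI !fZ mulrDl mulrA.
pose fL := GRing.isLinear.Build _ _ _ _ f fs.
exists (HB.pack f fL : {scalar E}) => v.
by change (to_real (f v) = g v); rewrite /f to_realB reI of_realK subr0.
Qed.

(** Hahn-Banach for the norm controls only the real part of [f]. Multiplying [v] by the inverse
    phase of [f v] makes the value real and nonnegative, which bounds the modulus. *)
Lemma norming_functional (R : realType) (k : scalar_kind)
    (E : normedModType (scalars R k)) (u : E) :
  exists f : {scalar E},
    (forall v, rnorm (f v) <= rnorm v) /\ rnorm (f u) = rnorm u.
Proof.
have [g [gl g_le gu]] := hahn_banach u (rnorm_sublinear E).
have [f fg] := real_linear_scalar gl.
have f_le v : rnorm (f v) <= rnorm v.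
  have [->|fv0] := eqVneq (f v) 0; first by rewrite rnorm0 rnorm_ge0.
  pose c := `|f v| / f v.
  have -> : rnorm (f v) = g (c *: v) by rewrite -fg scalarZ /c divfK.
  by apply: le_trans (g_le _) _; rewrite rnormZ rnorm_phase // mul1r.
exists f; split=> //; apply/eqP; rewrite eq_le f_le /= -gu -fg.
exact: to_real_le_norm.
Qed.

(** * Duality for the hypo-norms *)

Section FiniteHoelder.
Variables (R : realType) (m : nat).
Implicit Types (a c : 'I_m -> R) (p s : R).

Lemma powRVK s (x : R) : s != 0 -> 0 <= x -> (x `^ s^-1) `^ s = x.
Proof. by move=> s0 x0; rewrite -powRrM mulVf // powRr1. Qed.

Lemma sum_powR_ge0 s a : 0 <= \sum_j a j `^ s.
Proof. by apply: sumr_ge0 => j _; exact: powR_ge0. Qed.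

Lemma sum_powR_eq0 s a : \sum_j a j `^ s = 0 -> forall j, a j = 0.
Proof.
move=> /eqP; rewrite psumr_eq0 => [/allP as0 j|j _]; last exact: powR_ge0.
by have /eqP/powR_eq0_eq0 := as0 j (mem_index_enum j).
Qed.

(** Both sequences are scaled to have power sum 1, and Young's inequality is summed over the
    entries. If a power sum is zero, its sequence vanishes and so does the left side. *)
Lemma hoelder_sum p s c a : 0 < p -> 0 < s -> p^-1 + s^-1 = 1 ->
    (forall j, 0 <= c j) -> (forall j, 0 <= a j) ->
  \sum_j c j * a j <= (\sum_j c j `^ p) `^ p^-1 * (\sum_j a j `^ s) `^ s^-1.
Proof.
move=> p0 s0 ps c0 a0.
have normalized (q : R) (b : 'I_m -> R) : 0 < q -> (forall j, 0 <= b j) ->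
    \sum_j b j `^ q != 0 ->
    0 < (\sum_j b j `^ q) `^ q^-1 /\
    \sum_j (b j / (\sum_j b j `^ q) `^ q^-1) `^ q = 1.
  move=> q0 b0 Bn0; set B := \sum_j _ in Bn0 *.
  have B0 : 0 < B by rewrite lt_neqAle eq_sym Bn0 sum_powR_ge0.
  have Bq0 : 0 < B `^ q^-1 by exact: powR_gt0.
  split=> //; rewrite -[RHS](divff Bn0) {2}/B mulr_suml; apply: eq_bigr => j _.
  apply/(canRL (mulfK Bn0)).
  rewrite -{2}(powRVK (lt0r_neq0 q0) (ltW B0)) -powRM ?(ltW Bq0) //.
    by rewrite divfK ?gt_eqF.
  by rewrite divr_ge0 // ltW.
have [C0|Cn0] := eqVneq (\sum_j c j `^ p) 0.
  rewrite big1 => [|j _]; first by rewrite mulr_ge0 ?powR_ge0.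
  by rewrite (sum_powR_eq0 C0) mul0r.
have [A0|An0] := eqVneq (\sum_j a j `^ s) 0.
  rewrite big1 => [|j _]; first by rewrite mulr_ge0 ?powR_ge0.
  by rewrite (sum_powR_eq0 A0) mulr0.
have [C0 C1] := normalized p c p0 c0 Cn0.
have [A0 A1] := normalized s a s0 a0 An0.
set C := _ `^ p^-1 in C0 C1 *; set A := _ `^ s^-1 in A0 A1 *; clearbody C A.
have {C1 A1} : \sum_j (c j / C) * (a j / A) <= 1.
  have -> : 1 = \sum_j ((c j / C) `^ p / p + (a j / A) `^ s / s).
    rewrite big_split /= -ps; congr (_ + _).
      by rewrite -mulr_suml C1 mul1r.
    by rewrite -mulr_suml A1 mul1r.
  apply: ler_sum => j _.
  exact: (conjugate_powR (divr_ge0 (c0 j) (ltW C0)) (divr_ge0 (a0 j) (ltW A0))).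
have -> : \sum_j (c j / C) * (a j / A) = (\sum_j c j * a j) / (C * A).
  by rewrite mulr_suml; apply: eq_bigr => j _; rewrite invfM mulrACA.
rewrite ler_pdivrMr; [by rewrite mul1r | exact: mulr_gt0].
Qed.

End FiniteHoelder.

Section HypoNorm.
Variables (R : realType) (k : scalar_kind).
Local Notation K := (scalars R k).

Lemma hoelder_conjugate_fin (s : R) : 1 < s ->
  hoelder_conjugate s%:E = (s / (s - 1))%:E.
Proof.
move=> s1; rewrite /hoelder_conjugate /= eqe gt_eqF ?(lt_trans ltr01) //.
by rewrite -EFinD inver subr_eq0 gt_eqF.
Qed.

(** For [s = 1] the conjugate exponent is infinite and [lp_norm] is a maximum; otherwise this is
    Hoelder with exponents s/(s-1) and s. *)
Lemma pairing_le_lp_norm m (s : R) (l : 'I_m -> K) (a : 'I_m -> R) :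
    1 <= s -> (forall j, 0 <= a j) ->
    lp_norm (hoelder_conjugate s%:E) l <= 1 ->
  \sum_j rnorm (l j) * a j <= (\sum_j a j `^ s) `^ s^-1.
Proof.
move=> + a0; rewrite le_eqVlt => /predU1P[<-|s1].
  rewrite hoelder_conjugate1 /= => l1.
  rewrite invr1 powRr1 ?sum_powR_ge0 //; apply: ler_sum => j _.
  by rewrite powRr1 // ler_piMl // (le_trans _ l1) // rnorm_le_max.
rewrite hoelder_conjugate_fin //= => l1.
have s0 : 0 < s by exact: lt_trans s1.
have p0 : 0 < s / (s - 1) by rewrite divr_gt0 // subr_gt0.
have ps : (s / (s - 1))^-1 + s^-1 = 1.
  by rewrite invf_div mulrBl mul1r divff ?subrK ?gt_eqF.
apply: le_trans (hoelder_sum p0 s0 ps (fun j => rnorm_ge0 (l j)) a0) _.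
by rewrite ler_piMl // powR_ge0.
Qed.

(** The equality case of Hoelder: the moduli of [l] are proportional to |a_j|^(s-1), and the phases
    make every product real and nonnegative. *)
Lemma lp_norm_extremal m (s : R) (a : 'I_m -> K) : 1 <= s ->
  exists2 l : 'I_m -> K, lp_norm (hoelder_conjugate s%:E) l <= 1 &
    \sum_j l j * a j = of_real k ((\sum_j rnorm (a j) `^ s) `^ s^-1).
Proof.
rewrite le_eqVlt => /predU1P[<-|s1].
  have phase j : `|a j| / a j * a j = of_real k (rnorm (a j)).
    (* A quotient by zero is zero, so a vanishing entry gets the multiplier 0. *)
    have [->|aj0] := eqVneq (a j) 0; last by rewrite divfK // rnormE.
    by rewrite mulr0 rnorm0 rmorph0.
  exists (fun j => `|a j| / a j).
    rewrite hoelder_conjugate1 /=; apply: bigmax_le => [|j _].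
      exact: ler01.
    have [->|aj0] := eqVneq (a j) 0.
      by rewrite normr0 mul0r rnorm0 ler01.
    by rewrite rnorm_phase.
  rewrite invr1 powRr1 ?sum_powR_ge0 // rmorph_sum; apply: eq_bigr => j _.
  by rewrite powRr1 ?rnorm_ge0.
have s0 : 0 < s by exact: lt_trans s1.
have sn0 : s != 0 by rewrite gt_eqF.
have s1n0 : s - 1 != 0 by rewrite subr_eq0 gt_eqF.
have p0 : 0 < s / (s - 1) by rewrite divr_gt0 // subr_gt0.
rewrite hoelder_conjugate_fin //=; set S := \sum_j _.
have [S0|Sn0] := eqVneq S 0.
  exists (fun=> 0); last first.
    by rewrite S0 powR0 ?invr_eq0 // rmorph0 big1 // => j _; rewrite mul0r.
  rewrite big1 => [|j _]; last by rewrite rnorm0 powR0 // gt_eqF.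
  by rewrite powR0 ?invr_eq0 ?gt_eqF.
have Sgt0 : 0 < S by rewrite lt_neqAle eq_sym Sn0 /=; exact: sum_powR_ge0.
(* The power of [S] normalizes: raised to s/(s-1) it becomes 1/S, so that the powers of the moduli
   of [l] sum to at most 1. *)
pose w j := rnorm (a j) `^ (s - 1) * S `^ (s^-1 - 1).
exists (fun j => `|a j| / a j * of_real k (w j)).
  have sum1 : \sum_j rnorm (a j) `^ s / S = 1 by rewrite -mulr_suml divff.
  suff le1 j : rnorm (`|a j| / a j * of_real k (w j)) `^ (s / (s - 1))
      <= rnorm (a j) `^ s / S.
    apply: (@le_trans _ _ (1 `^ (s / (s - 1))^-1)); last by rewrite powR1.
    rewrite ge0_ler_powR ?nnegrE ?sum_powR_ge0 //.
      by rewrite invr_ge0 ltW.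
    by rewrite -[leRHS]sum1; apply: ler_sum => j _; exact: le1.
  have [->|aj0] := eqVneq (a j) 0.
    by rewrite normr0 !mul0r rnorm0 !powR0 ?gt_eqF ?mul0r.
  have -> : rnorm (`|a j| / a j * of_real k (w j)) = w j.
    rewrite rnormM rnorm_of_real rnorm_phase // mul1r ger0_norm //.
    by rewrite mulr_ge0 ?powR_ge0.
  rewrite /w powRM ?powR_ge0 // -!powRrM.
  have -> : (s - 1) * (s / (s - 1)) = s by rewrite mulrC divfK.
  have -> : (s^-1 - 1) * (s / (s - 1)) = -1 by field; rewrite sn0 s1n0.
  by rewrite powR_inv1 // ltW.
have term j : `|a j| / a j * of_real k (w j) * a j =
    of_real k (rnorm (a j) `^ s * S `^ (s^-1 - 1)).
  rewrite -(mulr_powRB1 (rnorm_ge0 (a j)) s0).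
  have [->|aj0] := eqVneq (a j) 0; first by rewrite rnorm0 !mul0r rmorph0 mulr0.
  by rewrite mulrAC divfK // rnormE -rmorphM mulrA.
rewrite (eq_bigr _ (fun j _ => term j)) -rmorph_sum -mulr_suml -/S.
by rewrite mulr_powRB1 ?ltW ?invr_gt0.
Qed.

Variables (E : normedModType K) (m : nat).
Implicit Types (x : 'I_m -> E) (s : R).

(** A crude bound, which makes the set in [hypo_norm] bounded, so that its [sup] is an upper
    bound. *)
Lemma rnorm_comb_le s (l : 'I_m -> K) x : 1 <= s ->
    lp_norm (hoelder_conjugate s%:E) l <= 1 ->
  rnorm (\sum_j l j *: x j) <= (\sum_j rnorm (x j) `^ s) `^ s^-1.
Proof.
move=> s1 l1; apply: le_trans (ler_rnorm_sum _ _ _) _.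
rewrite (eq_bigr _ (fun j _ => rnormZ (l j) (x j))).
by apply: pairing_le_lp_norm => // j; exact: rnorm_ge0.
Qed.

Lemma rnorm_comb_le_hypo s (l : 'I_m -> K) x : 1 <= s ->
    lp_norm (hoelder_conjugate s%:E) l <= 1 ->
  rnorm (\sum_j l j *: x j) <= hypo_norm s x.
Proof.
move=> s1 l1; apply: ub_le_sup; last by exists l.
exists ((\sum_j rnorm (x j) `^ s) `^ s^-1) => _ [l' l'1 <-].
exact: rnorm_comb_le.
Qed.

Lemma hypo_norm_ge0 s x : 1 <= s -> 0 <= hypo_norm s x.
Proof.
(* The extremal of the zero vector only supplies some admissible [l]. *)
move=> s1; have [l l1 _] := lp_norm_extremal ((fun=> 0) : 'I_m -> K) s1.
exact: le_trans (rnorm_ge0 _) (rnorm_comb_le_hypo x s1 l1).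
Qed.

(** First half of the duality: with the extremal multipliers for the values f(x_j), the left side is
    the modulus of [f] at an admissible combination. *)
Lemma sum_functional_le_hypo s x (f : {scalar E}) : 1 <= s ->
    (forall v, rnorm (f v) <= rnorm v) ->
  (\sum_j rnorm (f (x j)) `^ s) `^ s^-1 <= hypo_norm s x.
Proof.
move=> s1 f_le; have [l l1 lE] := lp_norm_extremal (fun j => f (x j)) s1.
apply: le_trans (rnorm_comb_le_hypo x s1 l1).
rewrite -[leLHS](ger0_norm (powR_ge0 _ _)) -(rnorm_of_real k) -lE.
have -> : \sum_j l j * f (x j) = f (\sum_j l j *: x j).
  by rewrite linear_sum; apply: eq_bigr => j _; rewrite scalarZ.
exact: f_le.
Qed.

Lemma sum_functional_powR_le_hypo s x (f : {scalar E}) : 1 <= s ->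
    (forall v, rnorm (f v) <= rnorm v) ->
  \sum_j rnorm (f (x j)) `^ s <= hypo_norm s x `^ s.
Proof.
move=> s1 f_le; have s0 : 0 < s by exact: lt_le_trans s1.
rewrite -[leLHS](@powRVK R s) ?gt_eqF ?sum_powR_ge0 //.
rewrite ge0_ler_powR ?nnegrE ?powR_ge0 ?hypo_norm_ge0 ?(ltW s0) //.
exact: sum_functional_le_hypo.
Qed.

(** Second half of the duality: each admissible combination has a norming functional [f], and
    Hoelder applies to the numbers |f(x_j)|. *)
Lemma hypo_norm_powR_le s x C : 1 <= s ->
    (forall f : {scalar E}, (forall v, rnorm (f v) <= rnorm v) ->
       \sum_j rnorm (f (x j)) `^ s <= C) ->
  hypo_norm s x `^ s <= C.
Proof.
move=> s1 fC; have s0 : 0 < s by exact: lt_le_trans s1.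
(* Any functional of norm at most one shows this; the root of [C] can then be taken. *)
have C0 : 0 <= C.
  have [f [f_le _]] := norming_functional (0 : E).
  exact: le_trans (sum_powR_ge0 _ _) (fC f f_le).
rewrite -[leRHS](@powRVK R s) ?gt_eqF //.
rewrite ge0_ler_powR ?nnegrE ?powR_ge0 ?hypo_norm_ge0 ?(ltW s0) //.
have [l0 l01 _] := lp_norm_extremal ((fun=> 0) : 'I_m -> K) s1.
apply: ge_sup; first by exists (rnorm (\sum_j l0 j *: x j)), l0.
move=> _ [l l1 <-].
have [f [f_le <-]] := norming_functional (\sum_j l j *: x j).
rewrite linear_sum; apply: le_trans (ler_rnorm_sum _ _ _) _.
have fE j : rnorm (f (l j *: x j)) = rnorm (l j) * rnorm (f (x j)).
  by rewrite scalarZ rnormM.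
rewrite (eq_bigr _ (fun j _ => fE j)).
apply: le_trans (pairing_le_lp_norm s1 (fun j => rnorm_ge0 _) l1) _.
by rewrite ge0_ler_powR ?nnegrE ?sum_powR_ge0 ?invr_ge0 ?(ltW s0) // fC.
Qed.

End HypoNorm.

(** * A discrete Gruess inequality for powers *)

Section DiscreteGruss.
Variable R : realType.
Implicit Types (a b d t : nat -> R) (q r M : R).

(** Convexity without derivatives: Young's inequality for x^(q-1) and y, with exponents q/(q-1) and
    q, multiplied by q. *)
Lemma powR_sub_le q (x y : R) : 1 <= q -> 0 <= y -> y <= x ->
  x `^ q - y `^ q <= q * x `^ (q - 1) * (x - y).
Proof.
move=> + y0 yx; have x0 := le_trans y0 yx.
rewrite le_eqVlt => /predU1P[<-|q1].
  by rewrite subrr powRr0 !powRr1 // !mul1r.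
have q0 : 0 < q by exact: lt_trans q1.
have qn0 : q != 0 by rewrite gt_eqF.
have q1n0 : q - 1 != 0 by rewrite subr_eq0 gt_eqF.
have p0 : 0 < q / (q - 1) by rewrite divr_gt0 // subr_gt0.
have pq : (q / (q - 1))^-1 + q^-1 = 1.
  by rewrite invf_div mulrBl mul1r divff ?subrK ?gt_eqF.
have := conjugate_powR (powR_ge0 x (q - 1)) y0 p0 q0 pq.
rewrite -powRrM [(q - 1) * _]mulrC divfK // invf_div => young.
rewrite mulrBr -[q * _ * x]mulrA [_ * x]mulrC mulr_powRB1 //.
have : q * (x `^ (q - 1) * y) <= (q - 1) * x `^ q + y `^ q.
  apply: le_trans (ler_wpM2l (ltW q0) young) _.
  by rewrite mulrDr ![q * (_ * _)]mulrCA divff // !mulr1 mulrC.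
by rewrite mulrA mulrBl mul1r; lra.
Qed.

Lemma powR_dist_le q M (x y : R) : 1 <= q -> 0 <= x <= M -> 0 <= y <= M ->
  `|x `^ q - y `^ q| <= q * M `^ (q - 1) * `|x - y|.
Proof.
move=> q1; wlog yx : x y / y <= x => [hw|/andP[x0 xM] /andP[y0 yM]].
  move=> xM yM; have [/hw|/ltW/hw] := leP y x; first exact.
  by rewrite distrC [`|x - y|]distrC; apply.
have q0 : 0 <= q by exact: le_trans q1.
rewrite !ger0_norm ?subr_ge0 ?ge0_ler_powR ?nnegrE //.
apply: le_trans (powR_sub_le q1 y0 yx) _.
rewrite ler_wpM2r ?subr_ge0 // ler_wpM2l // ge0_ler_powR ?nnegrE ?subr_ge0 //.
exact: le_trans xM.
Qed.

(** By induction: the new index [n] contributes exactly its pairs with the smaller indices. *)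
Lemma chebyshev_identity n a b :
  n%:R * (\sum_(i < n) a i * b i) - (\sum_(i < n) a i) * (\sum_(i < n) b i) =
  \sum_(j < n) \sum_(i < j) (a j - a i) * (b j - b i).
Proof.
elim: n => [|n IH]; first by rewrite !big_ord0 !mul0r subrr.
rewrite !big_ord_recr /= -IH -natr1.
have -> : \sum_(i < n) (a n - a i) * (b n - b i) =
    n%:R * (a n * b n) - a n * (\sum_(i < n) b i) - b n * (\sum_(i < n) a i)
    + \sum_(i < n) a i * b i.
  rewrite mulr_natl !mulr_sumr -[X in _ *+ X]card_ord -sumr_const.
  rewrite -!sumrB -big_split.
  by apply: eq_bigr => i _ /=; ring.
ring.
Qed.

(** Chebyshev's identity with equal sequences: the defect is a sum of squares. *)
Lemma sqr_sum_le n a : (\sum_(i < n) a i) ^+ 2 <= n%:R * \sum_(i < n) a i ^+ 2.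
Proof.
rewrite expr2 (eq_bigr _ (fun (i : 'I_n) _ => expr2 (a i))) -subr_ge0.
rewrite chebyshev_identity; apply: sumr_ge0 => j _; apply: sumr_ge0 => i _.
by rewrite -expr2 sqr_ge0.
Qed.

Lemma sum_nat_interval_le n i j a : (forall l, 0 <= a l) ->
  (i <= j <= n)%N -> \sum_(i <= l < j) a l <= \sum_(l < n) a l.
Proof.
move=> a0 /andP[ij jn]; rewrite -(big_mkord xpredT a).
rewrite (big_cat_nat (leq0n i) (leq_trans ij jn)) /= (big_cat_nat ij jn) /=.
by rewrite addrCA lerDl addr_ge0 // sumr_ge0.
Qed.

(** * Sums over index pairs *)

Lemma sum_gap (F : nat -> R) n : \sum_(i < n) F (n - i)%N = \sum_(i < n) F i.+1.
Proof.
rewrite (reindex_inj rev_ord_inj) /=; apply: eq_bigr => i _.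
by rewrite subKn.
Qed.

(** This sum and the next two, with weights 1, j - i and (j - i)^2, yield the constants 1/2, 1/6 and
    1/12 of the theorem after division by [n]. *)
Lemma sum_pairs n : \sum_(j < n) \sum_(i < j) 1 = n%:R * (n%:R - 1) / 2%:R :> R.
Proof.
elim: n => [|n IH]; first by rewrite big_ord0 !mul0r.
by rewrite big_ord_recr /= IH sumr_const card_ord -[n.+1%:R]natr1; field.
Qed.

Lemma sum_pairs_gap n :
  \sum_(j < n) \sum_(i < j) (j - i)%:R = n%:R * (n%:R ^+ 2 - 1) / 6%:R :> R.
Proof.
have inner m : \sum_(i < m) (m - i)%:R = m%:R * (m%:R + 1) / 2%:R :> R.
  rewrite (sum_gap (fun l => l%:R)); elim: m => [|m IH].
    by rewrite big_ord0 !mul0r.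
  by rewrite big_ord_recr /= IH -[m.+1%:R]natr1; field.
elim: n => [|n IH]; first by rewrite big_ord0 !mul0r.
by rewrite big_ord_recr /= IH inner -[n.+1%:R]natr1; field.
Qed.

Lemma sum_pairs_sqr_gap n : \sum_(j < n) \sum_(i < j) (j - i)%:R ^+ 2 =
  n%:R ^+ 2 * (n%:R ^+ 2 - 1) / 12%:R :> R.
Proof.
have inner m : \sum_(i < m) (m - i)%:R ^+ 2 =
    m%:R * (m%:R + 1) * (2%:R * m%:R + 1) / 6%:R :> R.
  rewrite (sum_gap (fun l => l%:R ^+ 2)); elim: m => [|m IH].
    by rewrite big_ord0 !mul0r.
  by rewrite big_ord_recr /= IH -[m.+1%:R]natr1; field.
elim: n => [|n IH]; first by rewrite big_ord0 expr0n !mul0r.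
by rewrite big_ord_recr /= IH inner -[n.+1%:R]natr1; field.
Qed.

(* Bounds the sum of [(t j - t i) ^+ 2] over [i < j] when [d] bounds the
   increments of [t]. *)
Definition spread n d : R :=
  \sum_(j < n) \sum_(i < j) (\sum_(i <= l < j) d l) ^+ 2.

(** Common frame of the three estimates: the weight [w] depends on the pair, the factor [c] does
    not. *)
Lemma spread_le n d c (w : nat -> nat -> R) :
    (forall i j, (i < j < n)%N -> (\sum_(i <= l < j) d l) ^+ 2 <= w i j * c) ->
  spread n d <= (\sum_(j < n) \sum_(i < j) w i j) * c.
Proof.
move=> dw; rewrite mulr_suml; apply: ler_sum => j _.
rewrite mulr_suml; apply: ler_sum => i _.
by apply: dw; rewrite !ltn_ord.
Qed.

Lemma spread_le_max n d D : (forall l, 0 <= d l) ->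
    (forall l, (l < n.-1)%N -> d l <= D) ->
  spread n d <= n%:R ^+ 2 * (n%:R ^+ 2 - 1) / 12%:R * D ^+ 2.
Proof.
move=> d0 dD; rewrite -sum_pairs_sqr_gap.
apply: (@spread_le _ _ _ (fun i j => (j - i)%:R ^+ 2)) => i j /andP[ij jn].
rewrite -exprMn lerXn2r ?nnegrE ?sumr_ge0 //.
  (* [D] is nonnegative because it bounds [d i]: from i < j < n, the index [i] lies below [n.-1]. *)
  rewrite mulr_ge0 ?ler0n // (le_trans (d0 i)) // dD //.
  by rewrite (leq_trans ij) // -ltnS prednK // (leq_ltn_trans _ jn).
rewrite mulr_natl -sumr_const_nat !big_nat; apply: ler_sum => l /andP[_ lj].
by rewrite dD // (leq_trans lj) // -ltnS prednK // (leq_ltn_trans _ jn).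
Qed.

(** Cauchy-Schwarz on the j - i terms of an interval gives the weight j - i; the sum of squares is
    then extended to the full range. *)
Lemma spread_le_sum_sqr n d : (forall l, 0 <= d l) ->
  spread n d <=
    n%:R * (n%:R ^+ 2 - 1) / 6%:R * \sum_(l < n.-1) d l ^+ 2.
Proof.
move=> d0; rewrite -sum_pairs_gap.
apply: (@spread_le _ _ _ (fun i j => (j - i)%:R)) => i j /andP[ij jn].
have shift a : \sum_(i <= l < j) a l = \sum_(l < j - i) a (l + i)%N.
  by rewrite -{1}(add0n i) big_addn big_mkord.
rewrite shift; apply: le_trans (sqr_sum_le _ (fun l => d (l + i)%N)) _.
rewrite ler_wpM2l ?ler0n // -(shift (fun l => (d l) ^+ 2)).
apply: sum_nat_interval_le => [l|]; first exact: sqr_ge0.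
by rewrite ltnW //= -ltnS prednK // (leq_ltn_trans _ jn).
Qed.

Lemma spread_le_sqr_sum n d : (forall l, 0 <= d l) ->
  spread n d <= n%:R * (n%:R - 1) / 2%:R * (\sum_(l < n.-1) d l) ^+ 2.
Proof.
move=> d0; rewrite -sum_pairs.
apply: (@spread_le _ _ _ (fun i j => 1)) => i j /andP[ij jn].
rewrite mul1r lerXn2r ?nnegrE ?sumr_ge0 //.
by rewrite sum_nat_interval_le // ltnW //= -ltnS prednK // (leq_ltn_trans _ jn).
Qed.

Lemma powR_gruss n q r M t d : (0 < n)%N -> 1 <= q -> 1 <= r ->
    (forall i, (i < n)%N -> 0 <= t i <= M) ->
    (forall i, `|t i.+1 - t i| <= d i) ->
  n%:R * \sum_(i < n) t i `^ (q + r) <=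
    (\sum_(i < n) t i `^ q) * (\sum_(i < n) t i `^ r) +
    q * r * M `^ (q + r - 2) * spread n d.
Proof.
move=> n0 q1 r1 tM td; rewrite -lerBlDl.
have q0 : 0 < q by exact: lt_le_trans q1.
have r0 : 0 < r by exact: lt_le_trans r1.
have tqr i : t i `^ (q + r) = t i `^ q * t i `^ r.
  by rewrite powRD // gt_eqF // addr_gt0.
rewrite (eq_bigr _ (fun (i : 'I_n) _ => tqr i)).
rewrite (chebyshev_identity _ (fun i => t i `^ q) (fun i => t i `^ r)).
rewrite mulr_sumr; apply: ler_sum => j _.
rewrite mulr_sumr; apply: ler_sum => i _.
have jn := ltn_ord j; have ij := ltn_ord i; have i_n := ltn_trans ij jn.
have M0 : 0 <= M by case/andP: (tM j jn) => t0; exact: le_trans.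
have MM : M `^ (q + r - 2) = M `^ (q - 1) * M `^ (r - 1).
  have -> : q + r - 2 = (q - 1) + (r - 1) by ring.
  (* Since [M] may be 0, exponents are added only if their sum is nonzero. It vanishes only for q =
     r = 1, where every power is 1 by the convention 0^0 = 1. *)
  have [qr0|qr0] := eqVneq (q - 1 + (r - 1)) 0; last first.
    by rewrite powRD ?(negbTE qr0).
  have [-> ->] : q = 1 /\ r = 1 by split; lra.
  by rewrite subrr addr0 powRr0 mulr1.
set T := \sum_(_ <= _ < _) _.
have tT : `|t j - t i| <= T.
  rewrite -telescope_sumr ?(ltnW ij) //; apply: le_trans (ler_norm_sum _ _ _) _.
  by apply: ler_sum => l _; exact: td.
have bound s : 1 <= s ->
    `|t j `^ s - t i `^ s| <= s * M `^ (s - 1) * T.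
  move=> s1; apply: le_trans (powR_dist_le s1 (tM j jn) (tM i i_n)) _.
  by rewrite ler_wpM2l // mulr_ge0 ?powR_ge0 // (le_trans ler01).
apply: le_trans (ler_norm _) _; rewrite normrM.
apply: le_trans
  (ler_pM (normr_ge0 _) (normr_ge0 _) (bound q q1) (bound r r1)) _.
by rewrite MM expr2 le_eqVlt; apply/orP; left; apply/eqP; ring.
Qed.

End DiscreteGruss.

(** * Conclusion *)

(** The part common to the three inequalities, with [C] standing for the bound on [spread] divided
    by [n]. The sequence [y] on all naturals spares ordinals in the interval sums. *)
Lemma hypo_norm_gruss (R : realType) (k : scalar_kind)
    (E : normedModType (scalars R k)) (n : nat) (y : nat -> E) (q r C : R) :
  (0 < n)%N -> 1 <= q -> 1 <= r ->
  (forall f : {scalar E}, (forall v, rnorm (f v) <= rnorm v) ->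
     spread n (fun l => rnorm (f (y l.+1 - y l))) <= n%:R * C) ->
  forall x : 'I_n -> E, x = (fun i : 'I_n => y i) ->
  hypo_norm (q + r) x `^ (q + r) <=
    n%:R^-1 * (hypo_norm q x `^ q) * (hypo_norm r x `^ r) +
    q * r * max_norm x `^ (q + r - 2) * C.
Proof.
move=> n0 q1 r1 spreadC x xE.
have nR0 : 0 < n%:R :> R by rewrite ltr0n.
have qr1 : 1 <= q + r by lra.
apply: hypo_norm_powR_le => // f f_le.
have yE (i : 'I_n) : f (x i) = f (y i) by rewrite xE.
rewrite -(ler_pM2l nR0) mulrDr !mulrA divff ?gt_eqF // mul1r.
have tM i : (i < n)%N -> 0 <= rnorm (f (y i)) <= max_norm x.
  move=> i_n; rewrite rnorm_ge0 (le_trans (f_le _)) //.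
  by have := rnorm_le_max x (Ordinal i_n); rewrite xE.
have td i : `|rnorm (f (y i.+1)) - rnorm (f (y i))| <= rnorm (f (y i.+1 - y i)).
  by rewrite linearB; exact: ler_dist_rnorm.
under eq_bigr do rewrite yE.
apply: le_trans (powR_gruss n0 q1 r1 tM td) _; apply: lerD.
  by rewrite ler_pM ?sum_powR_ge0 // xE;
    exact: (sum_functional_powR_le_hypo (fun i : 'I_n => y i)).
have -> : n%:R * q * r * max_norm x `^ (q + r - 2) * C =
    q * r * max_norm x `^ (q + r - 2) * (n%:R * C) by ring.
by rewrite ler_wpM2l ?spreadC // !mulr_ge0 ?powR_ge0 // (le_trans ler01).
Qed.

Theorem theorem6 (R : realType) (k : scalar_kind)
    (E : normedModType (scalars R k)) (n : nat) (hn : (2 <= n)%N)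
    (x : 'I_n -> E) (q r : R) (hq : 1 <= q) (hr : 1 <= r) :
  [/\ hypo_norm (q + r) x `^ (q + r) <=
        n%:R^-1 * (hypo_norm q x `^ q) * (hypo_norm r x `^ r) +
        12%:R^-1 * q * r * (n%:R ^+ 2 - 1) * n%:R *
          (max_norm x `^ (q + r - 2)) * max_norm (fwd_diff x) ^+ 2,
      forall alpha beta : R, 1 < alpha -> 1 < beta ->
        alpha^-1 + beta^-1 = 1 ->
        hypo_norm (q + r) x `^ (q + r) <=
          n%:R^-1 * (hypo_norm q x `^ q) * (hypo_norm r x `^ r) +
          6%:R^-1 * (n%:R ^+ 2 - 1) * q * r *
            (max_norm x `^ (q + r - 2)) *
            hypo_norm alpha (fwd_diff x) * hypo_norm beta (fwd_diff x)
    & hypo_norm (q + r) x `^ (q + r) <=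
        n%:R^-1 * (hypo_norm q x `^ q) * (hypo_norm r x `^ r) +
        2%:R^-1 * (n%:R - 1) * q * r *
          (max_norm x `^ (q + r - 2)) * hypo_norm 1 (fwd_diff x) ^+ 2].
Proof.
have [y ->] : exists y : nat -> E, x = (fun i : 'I_n => y i).
  (* Out of range [inord] returns a default index; the terms of [spread] never reach these
     values. *)
  case: n hn x => // n _ x; exists (fun i => x (inord i)).
  by apply: funext => i; rewrite inord_val.
have n0 : (0 < n)%N by exact: leq_trans hn.
have n1 : 1 <= n%:R :> R by rewrite ler1n.
have nR2 : 0 <= n%:R ^+ 2 - 1 :> R by rewrite subr_ge0 exprn_ege1.
set Dy := fwd_diff _.
pose d (f : {scalar E}) l := rnorm (f (y l.+1 - y l)).
have d0 f l : 0 <= d f l by exact: rnorm_ge0.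
(* By computation [d f l] is the modulus of [f] at entry [l] of [Dy], so the first half of the
   duality applies to the differences. *)
have sum_powR_le s (f : {scalar E}) : 1 <= s ->
    (forall v, rnorm (f v) <= rnorm v) ->
  (\sum_(l < n.-1) d f l `^ s) `^ s^-1 <= hypo_norm s Dy.
  by move=> s1 f_le; exact: (sum_functional_le_hypo Dy).
split.
- apply: le_trans (hypo_norm_gruss
    (C := n%:R * (n%:R ^+ 2 - 1) / 12%:R * max_norm Dy ^+ 2)
    n0 hq hr _ (erefl _)) _.
    move=> f f_le.
    have dD l : (l < n.-1)%N -> d f l <= max_norm Dy.
      move=> ln; apply: le_trans (f_le _) _.
      exact: (rnorm_le_max Dy (Ordinal ln)).
    apply: le_trans (spread_le_max (d0 f) dD) _.
    by rewrite le_eqVlt; apply/orP; left; apply/eqP; field.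
  have alg (P D : R) : q * r * P * (n%:R * (n%:R ^+ 2 - 1) / 12%:R * D ^+ 2) =
    12%:R^-1 * q * r * (n%:R ^+ 2 - 1) * n%:R * P * D ^+ 2 by field.
  by rewrite lerD2l alg.
- move=> alpha beta alpha1 beta1 ab.
  apply: le_trans (hypo_norm_gruss
    (C := (n%:R ^+ 2 - 1) / 6%:R * (hypo_norm alpha Dy * hypo_norm beta Dy))
    n0 hq hr _ (erefl _)) _.
    move=> f f_le.
    apply: le_trans (spread_le_sum_sqr n (d0 f)) _.
    rewrite !(mulrA n%:R) ler_wpM2l ?divr_ge0 ?mulr_ge0 ?ler0n //.
    (* Each square is read as a product, and Hoelder is applied to [d f] paired with itself. *)
    rewrite (eq_bigr _ (fun (l : 'I_n.-1) _ => expr2 (d f l))).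
    apply: le_trans (hoelder_sum _ _ ab (fun l => d0 f l) (fun l => d0 f l)) _.
    + exact: lt_trans alpha1.
    + exact: lt_trans beta1.
    + by rewrite ler_pM ?powR_ge0 // sum_powR_le // ltW.
  have alg (P A B : R) : q * r * P * ((n%:R ^+ 2 - 1) / 6%:R * (A * B)) =
    6%:R^-1 * (n%:R ^+ 2 - 1) * q * r * P * A * B by field.
  by rewrite lerD2l alg.
- apply: le_trans (hypo_norm_gruss
    (C := (n%:R - 1) / 2%:R * hypo_norm 1 Dy ^+ 2) n0 hq hr _ (erefl _)) _.
    move=> f f_le.
    apply: le_trans (spread_le_sqr_sum n (d0 f)) _.
    rewrite !(mulrA n%:R) ler_wpM2l ?divr_ge0 ?mulr_ge0 ?ler0n ?subr_ge0 //.
    have sum_le : \sum_(l < n.-1) d f l <= hypo_norm 1 Dy.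
      have := sum_powR_le 1 f (lexx 1) f_le.
      rewrite invr1 powRr1 ?sum_powR_ge0 //.
      by rewrite (eq_bigr _ (fun (l : 'I_n.-1) _ => powRr1 (d0 f l))).
    by rewrite lerXn2r ?nnegrE ?sumr_ge0 // (le_trans _ sum_le) ?sumr_ge0.
  have alg (P D : R) : q * r * P * ((n%:R - 1) / 2%:R * D ^+ 2) =
    2%:R^-1 * (n%:R - 1) * q * r * P * D ^+ 2 by field.
  by rewrite lerD2l alg.
Qed.
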